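(* For every instance of the problem $P2,S1|s_j,t_j|C_{max}$, the inequalities $$C_{max} \ge \sum_{j \in \mathcal{N}_1} A_j\, x_{j,k} \qquad \forall k \in M$$ are valid for the formulation $CF$, i.e. every feasible solution of $CF$ satisfies them.
   Context: An instance of $P2,S1|s_j,t_j|C_{max}$ consists of $n$ independent jobs $J_1,\dots,J_n$, each with loading time $s_j>0$, integer processing time $p_j>0$ and unloading time $t_j>0$; two identical machines $M=\{1,2\}$; and a single server. Put $A_j=s_j+p_j+t_j$. Each job is loaded, processed and unloaded on one machine, without delay between the three operations; loading and unloading occupy the server as well as the machine. Identify jobs with indices: $\mathcal{N}_1=\{1,\dots,n\}$ (jobs), $\mathcal{N}_2=\{n+1,\dots,2n\}$ (loading dummy jobs), $\mathcal{N}_3=\{2n+1,\dots,3n\}$ (unloading dummy jobs). Let $\rho_j=A_j$ for $j\in\mathcal{N}_1$, $\rho_j=s_{j-n}$ for $j\in\mathcal{N}_2$, $\rho_j=t_{j-2n}$ for $j\in\mathcal{N}_3$. Let $B$ be a large positive integer. The mixed-integer formulation $CF$ has continuous variables $C_{max}$ and $C_i$ ($i\in\mathcal{N}_1\cup\mathcal{N}_2\cup\mathcal{N}_3$), and binary variables $x_{i,k}$ ($i\in\mathcal{N}_1,k\in M$), $z_{i,j}$ ($i\neq j\in\mathcal{N}_1$), $y_{i,j}$ ($i\ne j\in\mathcal{N}_2\cup\mathcal{N}_3$). It minimizes $C_{max}$ subject to: - $C_{max}\ge C_i$ for all $i\in\mathcal{N}_1$; - $\sum_{k\in M}x_{i,k}=1$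 for all $i\in\mathcal{N}_1$; - $C_i\ge\rho_i$ for all $i\in\mathcal{N}_1\cup\mathcal{N}_2\cup\mathcal{N}_3$; - $C_i+\rho_j\le C_j+B(3-x_{i,k}-x_{j,k}-z_{i,j})$ for all $i\ne j\in\mathcal{N}_1$, $k\in M$; - $z_{i,j}+z_{j,i}=1$ for all $i\neq j\in\mathcal{N}_1$; - $C_i+\rho_j\le C_j+B(1-y_{i,j})$ for all $i\ne j\in\mathcal{N}_2\cup\mathcal{N}_3$; - $y_{i,j}+y_{j,i}=1$ for all $i\neq j\in\mathcal{N}_2\cup\mathcal{N}_3$; - $C_i=C_{i+n}+\rho_i-\rho_{i+n}$ for all $i\in\mathcal{N}_1$; - $C_i=C_{i+2n}$ for all $i\in\mathcal{N}_1$. *)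

(* Defs.v *)
(* MathComp *)
From mathcomp Require Import all_boot all_order all_algebra.

Set Implicit Arguments.
Unset Strict Implicit.
Unset Printing Implicit Defensive.

Import Order.TTheory GRing.Theory Num.Theory.
Local Open Scope ring_scope.

(* An instance of P2,S1|s_j,t_j|C_max.  Only the processing times are
   required to be integers.  There is at least one job: without jobs the
   formulation below does not bound C_max from below at all. *)
Record instance (R : realFieldType) := Instance {
  njobs : nat;
  load : 'I_njobs -> R;
  proc : 'I_njobs -> nat;
  unload : 'I_njobs -> R;
  njobs_gt0 : (0 < njobs)%N;
  load_gt0 : forall j, 0 < load j;
  proc_gt0 : forall j, (0 < proc j)%N;
  unload_gt0 : forall j, 0 < unload j
}.

Definition machine := 'I_2.

(* Indices are shifted to start at 0: the index set N1 u N2 u N3 is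
   {0, ..., 3n-1}, where N1 is the first block of length n, N2 the second and
   N3 the third; N2 u N3 is the type 'I_(n + n), embedded by [dummy]. *)
Definition job_index n := 'I_(n + (n + n)).
Definition job n (i : 'I_n) : job_index n := lshift (n + n) i.
Definition dummy n (d : 'I_(n + n)) : job_index n := rshift n d.
(* i + n, in N2 *)
Definition load_dummy n (i : 'I_n) : job_index n := dummy (lshift n i).
(* i + 2n, in N3 *)
Definition unload_dummy n (i : 'I_n) : job_index n := dummy (rshift n i).

Section Formulation.
Variables (R : realFieldType) (I : instance R).
Local Notation n := (njobs I).

Definition total_time (j : 'I_n) : R := load j + (proc j)%:R + unload j.

Definition rho (i : job_index n) : R :=
  match split i with
  | inl j => total_time j
  | inr d => match split d with inl j => load j | inr j => unload j end
  end.

(* Binary variables are booleans, used as 0/1 through the coercion to nat.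
   The diagonal values of sol_z and sol_y are not variables of the
   formulation: no constraint mentions them. *)
Record assignment := Assignment {
  sol_Cmax : R;
  sol_C : job_index n -> R;
  sol_x : 'I_n -> machine -> bool;
  sol_z : 'I_n -> 'I_n -> bool;
  sol_y : 'I_(n + n) -> 'I_(n + n) -> bool
}.

Record CF_feasible (B : nat) (sol : assignment) : Prop := CFFeasible {
  CF_makespan : forall i : 'I_n, sol_Cmax sol >= sol_C sol (job i);
  CF_machine : forall i : 'I_n, \sum_(k : machine) (sol_x sol i k)%:R = 1 :> R;
  CF_release : forall i : job_index n, sol_C sol i >= rho i;
  CF_job_order : forall (i j : 'I_n) (k : machine), i != j ->
    sol_C sol (job i) + rho (job j)
      <= sol_C sol (job j) + B%:R *
         (3 - (sol_x sol i k)%:R - (sol_x sol j k)%:R - (sol_z sol i j)%:R);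
  CF_z : forall i j : 'I_n, i != j ->
    (sol_z sol i j)%:R + (sol_z sol j i)%:R = 1 :> R;
  CF_server_order : forall i j : 'I_(n + n), i != j ->
    sol_C sol (dummy i) + rho (dummy j)
      <= sol_C sol (dummy j) + B%:R * (1 - (sol_y sol i j)%:R);
  CF_y : forall i j : 'I_(n + n), i != j ->
    (sol_y sol i j)%:R + (sol_y sol j i)%:R = 1 :> R;
  CF_load : forall i : 'I_n,
    sol_C sol (job i)
      = sol_C sol (load_dummy i) + rho (job i) - rho (load_dummy i);
  CF_unload : forall i : 'I_n,
    sol_C sol (job i) = sol_C sol (unload_dummy i)
}.

End Formulation.

(* Main.v *)
Require Import Defs.
From mathcomp Require Import all_boot all_order all_algebra.

(** The inequality says that a machine cannot finish before it has done all of
    its work.  Any two jobs assigned to machine [k] are ordered by the binary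
    variables [z], and the constraint of the chosen order loses its big-[B]
    term, whatever the value of [B]: one of the two jobs completes before the
    other starts ([same_machine_disjoint]).  The jobs on [k] thus occupy
    pairwise disjoint time intervals [[C_i - A_i, C_i]], which start no earlier
    than 0 and end no later than the makespan.  Lemma [sum_disjoint_le] bounds
    the total length of such intervals. *)

Set Implicit Arguments.
Unset Strict Implicit.
Unset Printing Implicit Defensive.

Import Order.TTheory GRing.Theory Num.Theory.
Local Open Scope ring_scope.

(** The interval ending last starts after all the others have ended, so
    removing it leaves intervals that fit before its start: induction applies
    with that start as the new [horizon]. *)
Lemma sum_disjoint_le (R : realDomainType) (T : finType) (len fin : T -> R)
    (S : {set T}) (horizon : R) :
    0 <= horizon ->
    {in S, forall i, 0 < len i} ->
    {in S, forall i, len i <= fin i <= horizon} ->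
    {in S &, forall i j, i != j ->
       (fin i + len j <= fin j) || (fin j + len i <= fin i)} ->
  \sum_(i in S) len i <= horizon.
Proof.
have [m] := ubnP #|S|; elim: m S horizon => // m IHm S horizon leSm h_ge0.
move=> len_gt0 fin_itv disj.
have [->|/set0Pn[i0 Si0]] := eqVneq S set0; first by rewrite big_set0.
have [i Si fin_max] : exists2 i, i \in S & {in S, forall j, fin j <= fin i}.
  by case: (arg_maxP fin Si0) => i Si fin_max; exists i.
have /andP[len_fin fin_h] := fin_itv i Si.
have rest_subset : {subset S :\ i <= S} by move=> j /setD1P[].
have rest_fits : \sum_(j in S :\ i) len j <= fin i - len i.
  apply: IHm.
  - by move: leSm; rewrite (cardsD1 i) Si.
  - by rewrite subr_ge0.
  - by move=> j /rest_subset; apply: len_gt0.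
  - move=> j /setD1P[neq_ji Sj].
    have /andP[-> _] /= := fin_itv j Sj.
    rewrite lerBrDr; case/orP: (disj j i Sj Si neq_ji) => // i_before_j.
    (* [j] would end strictly after [i], which ends last. *)
    have := fin_max j Sj; rewrite leNgt => /negP[].
    by apply: lt_le_trans i_before_j; rewrite ltrDl len_gt0.
  - by move=> j l /rest_subset Sj /rest_subset Sl; apply: disj.
rewrite (big_setD1 i) //= -lerBrDl.
by apply: le_trans rest_fits _; rewrite lerD2r.
Qed.

Lemma rho_job (R : realFieldType) (I : instance R) (j : 'I_(njobs I)) :
  rho (job j) = total_time j.
Proof. by rewrite /rho /job (unsplitK (inl j)). Qed.

Lemma total_time_gt0 (R : realFieldType) (I : instance R) (j : 'I_(njobs I)) :
  0 < total_time j.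
Proof. by rewrite !addr_gt0 ?load_gt0 ?unload_gt0 ?ltr0n ?proc_gt0. Qed.

Section Feasible.
Variables (R : realFieldType) (I : instance R) (B : nat) (sol : assignment I).
Hypothesis sol_feasible : CF_feasible B sol.

Lemma job_order_tight (i j : 'I_(njobs I)) (k : machine) :
    i != j -> sol_x sol i k -> sol_x sol j k -> sol_z sol i j ->
  sol_C sol (job i) + total_time j <= sol_C sol (job j).
Proof.
move=> neq_ij xik xjk zij; have := CF_job_order sol_feasible k neq_ij.
by rewrite xik xjk zij rho_job -!natrB // subnn mulr0 addr0.
Qed.

Lemma same_machine_disjoint (i j : 'I_(njobs I)) (k : machine) :
    i != j -> sol_x sol i k -> sol_x sol j k ->
  (sol_C sol (job i) + total_time j <= sol_C sol (job j)) ||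
  (sol_C sol (job j) + total_time i <= sol_C sol (job i)).
Proof.
move=> neq_ij xik xjk; have := CF_z sol_feasible neq_ij.
case zij: (sol_z sol i j); first by rewrite (job_order_tight neq_ij xik xjk).
case zji: (sol_z sol j i).
  by rewrite eq_sym in neq_ij; rewrite (job_order_tight neq_ij xjk xik) ?orbT.
by move/eqP; rewrite addr0 eq_sym oner_eq0.
Qed.

Lemma total_time_le_completion (j : 'I_(njobs I)) :
  total_time j <= sol_C sol (job j).
Proof. by rewrite -rho_job; apply: CF_release sol_feasible _. Qed.

(** Only the presence of a job keeps the makespan variable from being
    negative; this settles the case of an idle machine. *)
Lemma makespan_ge0 : 0 <= sol_Cmax sol.
Proof.
pose j := Ordinal (njobs_gt0 I).
apply: le_trans (CF_makespan sol_feasible j).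
exact: le_trans (ltW (total_time_gt0 j)) (total_time_le_completion j).
Qed.

End Feasible.

Theorem proposition1 (R : realFieldType) (I : instance R) (B : nat)
    (B_gt0 : (0 < B)%N) (sol : assignment I) (sol_feasible : CF_feasible B sol) :
  forall k : machine,
    sol_Cmax sol >= \sum_(j < njobs I) total_time j * (sol_x sol j k)%:R.
Proof.
move=> k; pose S := [set j | sol_x sol j k].
have -> : \sum_(j < njobs I) total_time j * (sol_x sol j k)%:R
            = \sum_(j in S) total_time j.
  rewrite [RHS]big_mkcond; apply: eq_bigr => j _.
  by rewrite inE; case: (sol_x sol j k); rewrite ?mulr1 ?mulr0.
apply: (sum_disjoint_le (fin := fun j => sol_C sol (job j))).
- exact: makespan_ge0 sol_feasible.
- by move=> j _; apply: total_time_gt0.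
- move=> j _; rewrite (total_time_le_completion sol_feasible).
  exact: CF_makespan sol_feasible j.
- move=> i j; rewrite !inE => xik xjk neq_ij.
  exact: (same_machine_disjoint sol_feasible neq_ij xik xjk).
Qed.
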